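(* Let $m>3$ and let $SD_m$ be the group generated by $x,y$ with relations $x^{2^{m-1}}=y^2=e$ and $yx=x^ky$, where $k=-1+2^{m-2}$. The saturated subsets of $SD_m$ are: $\{e,x^{2^{m-2}}\}$; the sets $\{x^{2j},x^{s}\}$ where $2j,s\not\equiv 0,2^{m-2}$ (modulo $2^{m-1}$) and $2j$ and $s$ have the same divisibility by $2$; and $A\cup B$, $A\cup C$, $B\cup C$, where $A=\{x,x^3,\ldots,x^{2^{m-1}-1}\}$, $B=\{y,yx^2,\ldots,yx^{2^{m-1}-2}\}$, $C=\{yx,yx^3,\ldots,yx^{2^{m-1}-1}\}$.
   Context: For a group $S$, a subset $U\subseteq S$ is avoidable if there is a partition $\{A',B'\}$ of $S$ such that no element of $U$ equals $uv$ with $u\neq v$ both in $A'$ or both in $B'$ (in either order). A subset is saturated if it is maximal with respect to inclusion among the avoidable subsets. Elements of $SD_m$ are written uniquely as $x^a$ or $yx^a$ with $a\in\mathbb{Z}/2^{m-1}\mathbb{Z}$. *)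

(* Defs.v *)
From mathcomp Require Import all_boot all_fingroup.

Set Implicit Arguments.
Unset Strict Implicit.
Unset Printing Implicit Defensive.

Local Open Scope group_scope.

(* [partition] forces both parts to be nonempty, and [A != B] excludes the    *)
(* one-block partition.  Quantifying over both (u, v) and (v, u) accounts for *)
(* the products u * v and v * u.                                              *)
Definition avoidable (gT : finGroupType) (S U : {set gT}) : bool :=
  (U \subset S) &&
  [exists A : {set gT}, exists B : {set gT},
     [&& A != B, partition [set A; B] S &
         [forall u, forall v,
            [&& u != v & (u \in A) && (v \in A) || (u \in B) && (v \in B)]
              ==> (u * v \notin U)]]].

Definition saturated (gT : finGroupType) (S U : {set gT}) : bool :=
  maxset (avoidable S) U.

(* G is the group SD_m and (x, y) is a pair of generators satisfying its      *)
(* defining relations, with k = -1 + 2 ^ (m - 2).  Since the presented group  *)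
(* is finite, it is isomorphic to G through the standard generators |-> x, y. *)
Definition semidihedral_presented (gT : finGroupType) (m : nat)
    (G : {group gT}) (x y : gT) : Prop :=
  let k := (2 ^ (m - 2) - 1)%N in
  [/\ G \isog Grp (a : b : a ^+ (2 ^ (m - 1)) = b ^+ 2 = 1,
                           b * a = a ^+ k * b),
      <<[set x; y]>> :=: G,
      x ^+ (2 ^ (m - 1)) = 1 /\ y ^+ 2 = 1
    & y * x = x ^+ k * y].

(* Main.v *)
Require Import Defs.
From mathcomp Require Import all_boot all_fingroup all_solvable.
From mathcomp Require Import all_order all_algebra.
From mathcomp Require Import zify ring.

(** U is avoidable iff some 2-colouring of the group separates u from v whenever
    u <> v and uv is in U.  Such a colouring is a pair (P, Q) of 8M-periodic
    colourings of the integers, P a and Q a being the colours of x^a and y x^a,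
    where x has order 8M = 2^(m-1).  An element x^s of U makes P alternate along
    the reflection a |-> s - a and Q along a |-> s - k a; an element y x^t makes
    P a differ from Q (t - a) and Q (t - k a).

    An even power x^s in U excludes all y x^t, all odd powers, even powers of
    another 2-adic valuation (they close an odd cycle on the y x^a; here 1 and
    x^(4M) count as a class of their own), and more than one further even power
    (three reflections give a triangle).  Without even powers, U cannot meet all
    three of A, B and C: elements of B and C force Q to be constant, which an
    element of A forbids.

    Conversely A u B, A u C and B u C are the complements of the subgroups of
    index 2.  For two even powers of valuation v, P exists because the graph of two
    reflections is a union of paths and even cycles, and Q a can be taken to be the
    binary digit of a of weight 2^v. *)

Local Open Scope group_scope.

(** * Obstructions to separating colourings *)

Section Colourings.

Local Open Scope ring_scope.
Import Order.TTheory GRing.Theory Num.Theory.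

Variable M : int.
Hypothesis M_gt0 : 0 < M.
(** The form in which M being a power of 2 is used here: odd integers are invertible modulo 8M. *)
Hypothesis inv_odd : forall w : int, exists u q : int, (2 * w + 1) * u = 1 + 8 * M * q.

Variables P Q : int -> bool.

Definition periodic (f : int -> bool) := forall a q, f (a + 8 * M * q) = f a.

(* [separatesX s] (resp. [separatesY t]) says that the colouring allows x^s
   (resp. y x^t) to be in U. *)
Definition separatesX (s : int) :=
  (forall a b q, a + b = s + 8 * M * q -> ~~ (8 * M %| a - b)%Z -> P a != P b)
  /\ (forall a b q, (4 * M - 1) * a + b = s + 8 * M * q ->
        ~~ (8 * M %| a - b)%Z -> Q a != Q b).

Definition separatesY (t : int) :=
  (forall a b q, a + b = t + 8 * M * q -> P a != Q b)
  /\ (forall a b q, (4 * M - 1) * a + b = t + 8 * M * q -> P a != Q b).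

Hypotheses (perP : periodic P) (perQ : periodic Q).

Lemma ndvdP (a : int) : (forall q, a <> 8 * (M * q)) -> ~~ (8 * M %| a)%Z.
Proof. by move=> h; apply/negP=> /dvdzP[q aE]; apply: (h q); rewrite aE; ring. Qed.

Lemma ndvd_half a : ~~ (8 * M %| a - (a + 4 * M))%Z.
Proof.
apply: ndvdP => q E; have : (2 * q + 1) * M = 0 by lia.
by move/eqP; rewrite mulf_eq0 (gt_eqF M_gt0) orbF => /eqP; lia.
Qed.

Lemma neqb_neqb (a b c : bool) : a != b -> b != c -> a = c.
Proof. by case: a b c => [] [] []. Qed.

Lemma dvdz_subC (d a b : int) : (d %| a - b)%Z = (d %| b - a)%Z.
Proof. by rewrite -opprB dvdzE abszN. Qed.

Lemma shift_iter (f : int -> bool) d :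
  (forall a, f (a + d) = f a) -> forall a i, f (a + d * i) = f a.
Proof.
move=> fd a i.
have fn (n : nat) c : f (c + d * n%:Z) = f c.
  elim: n => [|n IHn]; first by rewrite -[Posz 0]/(0 : int) mulr0 addr0.
  by rewrite -[RHS]IHn -[RHS]fd; rewrite -addn1 PoszD mulrDr mulr1 addrA.
case: (intP i) => [|n|n]; rewrite ?fn //.
by rewrite -(fn n.+1) mulrN subrK.
Qed.

Lemma flip_iter (f : int -> bool) d :
  (forall a, f a != f (a + d)) -> forall a i, f (a + 2 * d * i) = f a.
Proof.
move=> fd; apply: shift_iter => a; rewrite (neqb_neqb _ _ _ (fd a) (fd (a + d))).
by congr f; ring.
Qed.

(** The points [r - t + s], [s + t - r] and [r + t - s] have pairwise sums 2s, 2t and 2r. The three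
    reflections thus join them in a triangle, which has no proper 2-colouring. *)
Lemma separates_three r s t :
    ~~ (8 * M %| 2 * r - 2 * s)%Z -> ~~ (8 * M %| 2 * r - 2 * t)%Z ->
    ~~ (8 * M %| 2 * s - 2 * t)%Z ->
  separatesX (2 * r) -> separatesX (2 * s) -> separatesX (2 * t) -> False.
Proof.
move=> rs rt st [Xr _] [Xs _] [Xt _].
have h1 : P (r - t + s) != P (s + t - r).
  apply: (Xs _ _ 0); first by ring.
  by move: rt; congr (~~ (_ %| _)%Z); ring.
have h2 : P (s + t - r) != P (r + t - s).
  apply: (Xt _ _ 0); first by ring.
  by move: rs; rewrite dvdz_subC; congr (~~ (_ %| _)%Z); ring.
have h3 : P (r - t + s) != P (r + t - s).
  apply: (Xr _ _ 0); first by ring.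
  by move: st; congr (~~ (_ %| _)%Z); ring.
by rewrite (neqb_neqb _ _ _ h1 h2) eqxx in h3.
Qed.

(** With k = 4M - 1, both a and ka are joined to the same point t - ka of Q. *)
Lemma separatesY_mulK t a : separatesY t -> P ((4 * M - 1) * a) = P a.
Proof.
move=> [Y1 Y2]; have h1 := Y2 a (t - (4 * M - 1) * a) 0 ltac:(ring).
have h2 := Y1 ((4 * M - 1) * a) (t - (4 * M - 1) * a) 0 ltac:(ring).
by rewrite eq_sym in h1; rewrite (neqb_neqb _ _ _ h2 h1).
Qed.

(** If 2s is 0 or 4M modulo 8M, the reflection of P exchanges 2 and -2, or 1 and k = 4M - 1. These
    are pairs a, ka modulo 8M, on which P agrees. Otherwise the conflict arises between two values
    of Q. *)
Lemma separates_even_Y s t : separatesX (2 * s) -> separatesY t -> False.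
Proof.
move=> [Xs1 Xs2] Yt; have PK a := separatesY_mulK t a Yt.
case: Yt => Y1 Y2.
have [s4|s4] := boolP (4 * M %| 2 * s)%Z.
  have /dvdzP[q sE] := s4.
  have [r [qE|qE]] : exists r, q = 2 * r \/ q = 2 * r + 1.
    by exists (q %/ 2)%Z; lia.
  - have /negP[] : P 2 != P (- 2).
      apply: (Xs1 _ _ (- r)); first by rewrite sE qE; ring.
      by apply: ndvdP => i; lia.
    by rewrite -(PK 2) -(perP _ (-1)); apply/eqP; congr P; ring.
  have /negP[] : P 1 != P (4 * M - 1).
    apply: (Xs1 _ _ (- r)); first by rewrite sE qE; ring.
    by apply: ndvdP => i; lia.
  by rewrite -(PK 1) mulr1.
(* This [g] solves k(t - kg) + (t - g) = 2s modulo 8M, so x^(2s) must separate two points of Q that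
   are both opposite to [P g]. *)
pose g := 2 * M * t - s.
have h1 := Y2 g (t - (4 * M - 1) * g) 0 ltac:(ring).
have h2 := Y1 g (t - g) 0 ltac:(ring).
have /negP[] : Q (t - (4 * M - 1) * g) != Q (t - g).
  apply: (Xs2 _ _ (g * (1 - 2 * M))); first by rewrite /g; ring.
  apply: ndvdP => q E; case/negP: s4; apply/dvdzP.
  exists (t - g - 2 * q); rewrite /g in E *; lia.
by rewrite eq_sym in h1; rewrite (neqb_neqb _ _ _ h1 h2).
Qed.

(** For s = 2t + 1, applying a |-> s - ka twice moves d by (1 - k)s = 2s - 4Ms, which is 2s + 4M
    modulo 8M because s is odd. The parity of d only decides whether the point in between is d + s
    or d + s + 4M. *)
Lemma separates_odd_shift t d :
  separatesX (2 * t + 1) -> Q (d + 2 * (2 * t + 1 + 2 * M)) = Q d.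
Proof.
move=> [_ X]; have [i [dE|dE]] : exists i, d = 2 * i \/ d = 2 * i + 1.
- by exists (d %/ 2)%Z; lia.
- have h1 : Q d != Q (d + (2 * t + 1)).
    by apply: (X _ _ i); [rewrite dE; ring | apply: ndvdP => q; lia].
  have h2 : Q (d + (2 * t + 1)) != Q (d + 2 * (2 * t + 1 + 2 * M)).
    by apply: (X _ _ (i + t + 1)); [rewrite dE; ring | apply: ndvdP => q; lia].
  by rewrite (neqb_neqb _ _ _ h1 h2).
- have h1 : Q d != Q (d + (2 * t + 1) + 4 * M).
    by apply: (X _ _ (i + 1)); [rewrite dE; ring | apply: ndvdP => q; lia].
  have h2 : Q (d + (2 * t + 1) + 4 * M) != Q (d + 2 * (2 * t + 1 + 2 * M)).
    by apply: (X _ _ (i + t + 1 + 2 * M)); [rewrite dE; ring | apply: ndvdP => q; lia].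
  by rewrite (neqb_neqb _ _ _ h1 h2).
Qed.

(** The odd power makes Q invariant under twice an odd number. Odd numbers being invertible modulo
    8M, Q has period 2, but the even power separates two points of equal parity. *)
Lemma separates_even_odd s t :
  separatesX (2 * s) -> separatesX (2 * t + 1) -> False.
Proof.
move=> [_ Xs] Xt; have [u [q uE]] := inv_odd (t + M).
have Q2 d i : Q (d + 2 * i) = Q d.
  have := shift_iter Q _ (fun d => separates_odd_shift t d Xt) d (u * i).
  move=> <-; rewrite -[LHS](perQ _ (2 * q * i)); congr (Q _).
  transitivity (d + 2 * i * (1 + 8 * M * q)); first by ring.
  by rewrite -uE; ring.
(* If 2s vanishes modulo 8M, the point 0 is its own mirror image; the point 1, with image 1 + 4M,
   takes its place. *)
have [/dvdzP[r sE]|s0] := boolP (8 * M %| 2 * s)%Z; last first.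
  have /negP[] : Q 0 != Q (2 * s).
    apply: (Xs _ _ 0); first by ring.
    by rewrite dvdz_subC subr0.
  by rewrite -[2 * s]add0r Q2.
have /negP[] : Q 1 != Q (1 + 4 * M).
  apply: (Xs _ _ (1 - r)); first by rewrite sE; ring.
  exact: ndvd_half.
have -> : 1 + 4 * M = 1 + 2 * (2 * M) by ring.
by rewrite Q2.
Qed.

(** For w = 2(d - b) + 1, the points a and a + w of Q are both joined to the point 2b - a of P. So Q
    has the odd period w besides 8M and is constant. *)
Lemma separates_odd_Y t b d :
    separatesX (2 * t + 1) -> separatesY (2 * b) -> separatesY (2 * d + 1) ->
  False.
Proof.
move=> [_ X] [Yb _] [Yd _]; have [u [q uE]] := inv_odd (d - b).
have Qw a : Q (a + (2 * (d - b) + 1)) = Q a.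
  have h1 := Yb (2 * b - a) a 0 ltac:(ring).
  have h2 := Yd (2 * b - a) (a + (2 * (d - b) + 1)) 0 ltac:(ring).
  by rewrite eq_sym in h2; rewrite (neqb_neqb _ _ _ h2 h1).
have /negP[] : Q 0 != Q (2 * t + 1).
  by apply: (X _ _ 0); [ring | apply: ndvdP => i; lia].
rewrite -(shift_iter Q _ Qw 0 (u * (2 * t + 1))) mulrA uE.
by rewrite -(perQ (2 * t + 1) (q * (2 * t + 1))); apply/eqP; congr Q; ring.
Qed.

(** As D divides M, the reflection of Q in 2D(2s + 1) acts on the even points, and likewise on the
    odd points, as a shift by an odd multiple of 2D modulo 8M. An even number of these shifts
    preserves the colour and yet adds up to a displacement across which x^(4Dt) must change it. *)
Lemma separates_valuation D e s t :
    M = D * e -> separatesX (2 * D * (2 * s + 1)) -> separatesX (4 * D * t) ->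
  False.
Proof.
move=> ME [_ Xs] [_ Xt].
have D0 : D != 0 by apply: contraTneq M_gt0; rewrite ME => ->; rewrite mul0r.
have oddD z w : ~~ (8 * M %| z - (z + 2 * D * (2 * w + 1)))%Z.
  apply: ndvdP => q; rewrite ME => E.
  suff : 2 * w + 1 = 4 * - (e * q) by lia.
  apply: (mulfI D0); lia.
(* If 4Dt is 0 modulo 8M, its reflection fixes the even points and moves the odd ones by 4M, so the
   odd points are used. *)
have [/dvdzP[r tE]|t0] := boolP (8 * M %| 4 * D * t)%Z.
  have [u [q uE]] := inv_odd (s + e).
  have flip a : Q (2 * a + 1) != Q (2 * (a + D * (2 * (s + e) + 1)) + 1).
    apply: (Xs _ _ (a + 1)); first by rewrite ME; ring.
    have -> : 2 * (a + D * (2 * (s + e) + 1)) + 1 =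
      (2 * a + 1) + 2 * D * (2 * (s + e) + 1) by ring.
    exact: oddD.
  have := flip_iter (fun a => Q (2 * a + 1)) _ flip 0 (e * u).
  have /negP h : Q 1 != Q (1 + 4 * M).
    apply: (Xt _ _ (1 - r)); first by rewrite tE; ring.
    exact: ndvd_half.
  move=> E; apply: h; rewrite -[Q 1]E -(perQ (1 + 4 * M) (4 * M * q)).
  apply/eqP; congr Q.
  transitivity (4 * (D * e) * ((2 * (s + e) + 1) * u) + 1); first by ring.
  by rewrite uE -ME; ring.
have [u [q uE]] := inv_odd s.
have flip a : Q (2 * a) != Q (2 * (a + D * (2 * s + 1))).
  apply: (Xs _ _ a); first by ring.
  rewrite mulrDr mulrA; exact: oddD.
have /negP[] : Q 0 != Q (4 * D * t).
  by apply: (Xt _ _ 0); [ring | rewrite dvdz_subC subr0].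
rewrite -(flip_iter (fun a => Q (2 * a)) _ flip 0 (t * u)).
rewrite -(perQ (4 * D * t) (4 * D * t * q)); apply/eqP; congr Q.
transitivity (4 * D * t * (1 + 8 * M * q)); last by ring.
by rewrite -uE; ring.
Qed.

End Colourings.

(** * Construction of separating colourings *)

Section Existence.

Local Open Scope ring_scope.
Import Order.TTheory GRing.Theory Num.Theory.

Variable M : int.
Hypothesis M_gt0 : 0 < M.
Hypothesis inv_odd : forall w : int, exists u q : int, (2 * w + 1) * u = 1 + 8 * M * q.

(** The colour is the parity of the quotient of a by D, which an odd multiple of D flips; it is
    8M-periodic because 8M = 2eD. *)
Lemma digit_colouring (D e : int) : 0 < D -> 4 * M = D * e ->
  exists2 Q, periodic M Q & forall a b i, b = a + D * (2 * i + 1) -> Q a != Q b.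
Proof.
move=> D0 ME; have D1 : D != 0 by rewrite gt_eqF.
exists (fun a => ((a %/ D)%Z %% 2)%Z == 1) => [a q|a b i ->].
  have -> : a + 8 * M * q = (2 * e * q) * D + a.
    by transitivity (a + 2 * (4 * M) * q); [ring | rewrite ME; ring].
  by rewrite divzMDl // -mulrA [2 * _]mulrC modzMDl.
rewrite addrC [D * _]mulrC divzMDl //; lia.
Qed.

(** Write a = 2Fq + r. For r other than 0 and F, both reflections exchange the residues r and 2F -
    r, so r < F is a valid colour. For r = 0 they act on q modulo 2n as q |-> -q and q |-> 1 - q,
    for r = F as q |-> -1 - q and q |-> -q. Either way the graph is a path from 0 to n, coloured by
    a half of the cycle of length 2n. *)
Lemma reflections_colouring (F n : int) : 0 < F -> 4 * M = 2 * F * n ->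
  exists2 c, periodic M c & forall a b q, a + b = 8 * M * q \/ a + b = 2 * F + 8 * M * q ->
    ~~ (8 * M %| a - b)%Z -> c a != c b.
Proof.
move=> F0 ME; have E0 : 2 * F != 0 by lia.
have n0 : 0 < n by rewrite -(pmulr_rgt0 n F0); lia.
have M8 : 8 * M = (2 * F) * (2 * n) by rewrite mulrCA -ME; ring.
pose c a := let r := (a %% (2 * F))%Z in
  let q := ((a %/ (2 * F))%Z %% (2 * n))%Z in
  if r == 0 then 0 < q <= n else if r == F then q < n else r < F.
exists c => [a q|a b j ab ndvd].
  rewrite /c; have -> : a + 8 * M * q = (q * (2 * n)) * (2 * F) + a by rewrite M8; ring.
  by rewrite divzMDl // !modzMDl.
have decomp z : exists i q r, [/\ z = 8 * M * i + 2 * F * q + r, 0 <= q < 2 * n,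
    0 <= r < 2 * F & c z = if r == 0 then 0 < q <= n else if r == F then q < n else r < F].
  exists ((z %/ (2 * F))%Z %/ (2 * n))%Z, ((z %/ (2 * F))%Z %% (2 * n))%Z, (z %% (2 * F))%Z.
  split=> //.
  - rewrite {1}[z](divz_eq _ (2 * F)) {1}[(z %/ _)%Z](divz_eq _ (2 * n)) M8; ring.
  - by rewrite modz_ge0 ?ltz_pmod //; lia.
  - by rewrite modz_ge0 ?ltz_pmod //; lia.
have [i [q [r [aE q0 r0 ->]]]] := decomp a.
have [i' [q' [r' [bE q'0 r'0 ->]]]] := decomp b.
have [k [k01 ab']] : exists k, (k = 0 \/ k = 1) /\ a + b = 2 * F * k + 8 * M * j.
  by case: ab => ->; [exists 0 | exists 1]; (split; [by auto|ring]).
(* [h] is the carry from the remainders modulo 2F and [J] the number of periods 2n passed by the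
   quotients. Both turn out to be 0 or 1, which leaves linear goals. *)
have [J JE] : exists J, J = j - i - i' by exists (j - i - i').
have [h hE] : exists h, h = 2 * n * J - q - q' + k by eexists.
have rr : r + r' = 2 * F * h.
  have : r + r' = a + b - 8 * M * (i + i') - 2 * F * (q + q') by rewrite aE bE; ring.
  by rewrite ab' M8 => ->; rewrite hE JE; ring.
have h01 : h = 0 \/ h = 1.
  have h0 : 0 <= h by rewrite -(pmulr_rge0 h F0); lia.
  have h1 : h < 2 by rewrite -(ltr_pM2l F0); lia.
  lia.
have J01 : J = 0 \/ J = 1.
  have J0 : -1 < J by rewrite -(ltr_pM2l n0); lia.
  have J1 : J < 2 by rewrite -(ltr_pM2l n0); lia.
  lia.
have qq : r = r' -> q != q'.
  move=> rE; apply: contra ndvd => /eqP qE; apply/dvdzP; exists (i - i').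
  by rewrite aE bE rE qE; ring.
clear JE aE bE ab ab' ndvd decomp c.
have nJ : n * J = 0 \/ n * J = n.
  by case: J01 => ->; [left; rewrite mulr0 | right; rewrite mulr1].
rewrite -mulrA in hE; clear J01 M8 ME.
case: h01 => h0; rewrite {}h0 in rr hE.
  have r00 : r = 0 by lia.
  have r'00 : r' = 0 by lia.
  have := qq (etrans r00 (esym r'00)); rewrite r00 r'00 eqxx => /eqP.
  case: nJ => nJ; rewrite {}nJ in hE; case: k01 => kE; rewrite {}kE in hE; lia.
have r00 : r == 0 = false by lia.
have r'00 : r' == 0 = false by lia.
rewrite r00 r'00; have [rF|rF] := eqVneq r F; last first.
  have -> : r' == F = false by lia.
  lia.
have r'F : r' = F by lia.
have := qq (etrans rF (esym r'F)); rewrite r'F eqxx => /eqP.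
case: nJ => nJ; rewrite {}nJ in hE; case: k01 => kE; rewrite {}kE in hE; lia.
Qed.

(** With u inverse to 2w + 1 modulo 8M, the substitution a |-> u(a - s) carries the two reflections
    of P to those with sums 0 and 2F. For Q, a digit colouring works once mirror images differ by
    odd multiples of D. *)
Lemma separates_pair (s w F n D e : int) :
    0 < F -> 4 * M = 2 * F * n -> 0 < D -> 4 * M = D * e ->
    (forall a b q, (4 * M - 1) * a + b = 2 * s + 8 * M * q ->
       ~~ (8 * M %| a - b)%Z -> exists i, b = a + D * (2 * i + 1)) ->
    (forall a b q, (4 * M - 1) * a + b = 2 * s + 2 * F * (2 * w + 1) + 8 * M * q ->
       ~~ (8 * M %| a - b)%Z -> exists i, b = a + D * (2 * i + 1)) ->
  exists P Q, [/\ periodic M P, periodic M Q, separatesX M P Q (2 * s)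
    & separatesX M P Q (2 * s + 2 * F * (2 * w + 1))].
Proof.
move=> F0 FE D0 DE Qs Qt.
have [Q perQ Qdiff] := digit_colouring D e D0 DE.
have [c perc cdiff] := reflections_colouring F n F0 FE.
have [u [z uE]] := inv_odd w.
have cu a b : ~~ (8 * M %| a - b)%Z -> ~~ (8 * M %| u * (a - s) - u * (b - s))%Z.
  apply: contra => /dvdzP[k kE]; apply/dvdzP; exists ((2 * w + 1) * k - z * (a - b)).
  rewrite mulrBl -[(2 * w + 1) * k * _]mulrA -kE.
  transitivity ((2 * w + 1) * u * (a - b) - z * (a - b) * (8 * M)); last by ring.
  by rewrite uE; ring.
exists (fun a => c (u * (a - s))), Q; split=> //.
- move=> a q; rewrite -(perc (u * (a - s)) (u * q)); congr c; ring.
- split=> a b q ab /[dup] ndvd /cu ndvd'; last by have [k] := Qs a b q ab ndvd; apply: Qdiff.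
  apply: (cdiff _ _ (u * q)) => //; left.
  transitivity (u * (a + b - 2 * s)); [ring | rewrite ab; ring].
- split=> a b q ab /[dup] ndvd /cu ndvd'; last by have [k] := Qt a b q ab ndvd; apply: Qdiff.
  apply: (cdiff _ _ (u * q + 2 * F * z)) => //; right.
  transitivity (u * (a + b - 2 * s)); [ring | rewrite ab].
  transitivity (2 * F * ((2 * w + 1) * u) + 8 * M * u * q); [ring | rewrite uE; ring].
Qed.

(** For the sum 0, the reflection of Q fixes the even points and moves the odd ones by 4M; for the
    sum 4M the parities exchange roles. Hence D = 4M. *)
Lemma separates_unit_half :
  exists P Q, [/\ periodic M P, periodic M Q, separatesX M P Q 0
    & separatesX M P Q (4 * M)].
Proof.
have [M2 M4] : 0 < 2 * M /\ 0 < 4 * M by split; lia.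
have [M4E M4E'] : 4 * M = 2 * (2 * M) * 1 /\ 4 * M = 4 * M * 1 by split; ring.
have [a b q E nd|a b q E nd|P [Q []]] :=
  separates_pair 0 0 (2 * M) 1 (4 * M) 1 M2 M4E M4 M4E'.
- have [k [kE|kE]] : exists k, a = 2 * k \/ a = 2 * k + 1.
    by exists (a %/ 2)%Z; lia.
    case/negP: nd; apply/dvdzP; exists (k - q).
    by rewrite -(addKr ((4 * M - 1) * a) b) E kE; ring.
  by exists (q - k - 1); rewrite -(addKr ((4 * M - 1) * a) b) E kE; ring.
- have [k [kE|kE]] : exists k, a = 2 * k \/ a = 2 * k + 1.
    by exists (a %/ 2)%Z; lia.
    by exists (q - k); rewrite -(addKr ((4 * M - 1) * a) b) E kE; ring.
  case/negP: nd; apply/dvdzP; exists (k - q).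
  by rewrite -(addKr ((4 * M - 1) * a) b) E kE; ring.
rewrite !mulr0 !add0r mulr1 => perP perQ X0 X4; exists P, Q; split=> //.
by have -> : 4 * M = 2 * (2 * M) by ring.
Qed.

(** Since 4M is an even multiple of 2D, both reflections of Q move every point by an odd multiple of
    2D, so one digit colouring serves both. *)
Lemma separates_same_valuation (D e s t F n w : int) :
    0 < D -> M = D * e -> 0 < F -> 4 * M = 2 * F * n ->
    2 * D * (2 * t + 1) - 2 * D * (2 * s + 1) = 2 * F * (2 * w + 1) ->
  exists P Q, [/\ periodic M P, periodic M Q,
    separatesX M P Q (2 * D * (2 * s + 1))
    & separatesX M P Q (2 * D * (2 * t + 1))].
Proof.
move=> D0 ME F0 FE stE.
have tE : 2 * D * (2 * t + 1) = 2 * (D * (2 * s + 1)) + 2 * F * (2 * w + 1).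
  by rewrite -stE; ring.
have [D2 M4E] : 0 < 2 * D /\ 4 * M = 2 * D * (2 * e).
  by split; [lia | rewrite ME; ring].
have [a b q E nd|a b q E nd|P [Q []]] :=
  separates_pair (D * (2 * s + 1)) w F n (2 * D) (2 * e) F0 FE D2 M4E.
- exists (s - e * a + 2 * e * q).
  by rewrite -(addKr ((4 * M - 1) * a) b) E ME; ring.
- exists (t - e * a + 2 * e * q).
  by rewrite -(addKr ((4 * M - 1) * a) b) E -tE ME; ring.
by rewrite -tE [2 * (D * _)]mulrA; exists P, Q.
Qed.

End Existence.

(** * The semidihedral group *)

(** The group ['SD_(2 ^ m)] satisfies the relations, so G maps onto it and has at least 2^m
    elements. As G is the product of cyclic groups of orders at most 2^(m-1) and 2, the order of x
    is as large as allowed and y lies outside <x>. *)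
Lemma semidihedral_presented_structure (gT : finGroupType) m (G : {group gT}) x y :
    (3 < m)%N -> semidihedral_presented m G x y ->
  [/\ #[x] = (2 ^ (m - 1))%N, y \notin <[x]>, y ^+ 2 = 1,
      y * x = x ^+ (2 ^ (m - 2) - 1) * y & <[x]> * <[y]> = G].
Proof.
move=> m_gt3 [isoG genG [xN y2] yx].
have homSD : 'SD_(2 ^ m) \homg G.
  rewrite isoG; have := isoGrp_hom (Grp_semidihedral m_gt3).
  case/existsP=> -[u v] /=; rewrite !xpair_eqE => /and4P[genSD /eqP uN /eqP v2 /eqP uv].
  have vV : v^-1 = v by apply: (mulgI v); rewrite mulgV.
  apply/existsP; exists (u, v) => /=; rewrite !xpair_eqE genSD /=.
  rewrite -!subn1 -subnDA in uN uv.
  rewrite uN v2 !eqxx /= -uv conjgE vV -!mulgA.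
  by have -> : v * v = 1 by []; rewrite mulg1.
have yV : y^-1 = y by apply: (mulgI y); rewrite mulgV.
have defG : <[x]> * <[y]> = G.
  rewrite -genG -[<<_>>]/(<<[set x] :|: [set y]>>) -joingE -joing_idl -joing_idr.
  rewrite norm_joinEr // cycle_subG inE -cycleJ cycle_subG conjgE yV mulgA yx.
  by rewrite -mulgA (_ : y * y = 1) // mulg1 mem_cycle.
have oG : (2 ^ m <= #|G|)%N.
  rewrite -(card_semidihedral m_gt3).
  by case/homgP: homSD => f <-; apply: leq_morphim.
have oy : (#[y] <= 2)%N by rewrite dvdn_leq // order_dvdn y2.
have oxN : (#[x] <= 2 ^ (m - 1))%N by rewrite dvdn_leq ?expn_gt0 // order_dvdn xN.
have m2 : (2 ^ m = 2 ^ (m - 1) * 2)%N by rewrite -expnSr; congr (2 ^ _)%N; lia.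
have pN : (0 < 2 ^ (m - 1))%N by rewrite expn_gt0.
have yNx : y \notin <[x]>.
  apply/negP => yx'; move: oG; rewrite -defG mulGSid ?cycle_subG // leqNgt m2.
  by move/negP; apply; rewrite -/(#[x]); lia.
split=> //.
have oxy : (#|G| <= #[x] * #[y])%N by rewrite -defG !orderE mul_cardG leq_pmulr ?cardG_gt0.
nia.
Qed.

Section Semidihedral.

Variables (gT : finGroupType) (G : {group gT}) (x y : gT) (j : nat).
Hypothesis ox : #[x] = (8 * 2 ^ j)%N.
Hypothesis yNx : y \notin <[x]>.
Hypothesis y2 : y ^+ 2 = 1.
Hypothesis yx : y * x = x ^+ (4 * 2 ^ j - 1) * y.
Hypothesis defG : <[x]> * <[y]> = G.

Local Open Scope ring_scope.
Import Order.TTheory GRing.Theory Num.Theory.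

(** * Integer powers of x and multiplication in G *)

Let M : int := (2 ^ j)%N.

(** Powers of x with exponents in the integers, where the colourings live. *)
Definition cyclic_expz (a : int) : gT := (x ^+ `|(a %% (8 * M))%Z|)%g.

Local Notation X := cyclic_expz.

Lemma X_nat (n : nat) : X n%:Z = (x ^+ n)%g.
Proof.
rewrite /cyclic_expz /M -PoszM modz_nat absz_nat; apply/eqP.
by rewrite eq_expg_mod_order ox modn_mod.
Qed.

Lemma X_period a q : X (a + 8 * M * q) = X a.
Proof. by rewrite /cyclic_expz addrC [_ * q]mulrC modzMDl. Qed.

Let M_gt0 : 0 < M. Proof. by rewrite /M ltz_nat expn_gt0. Qed.

Lemma X_repr a : exists n q, a = n%:Z + 8 * M * q.
Proof.
have M0 := M_gt0; exists `|(a %% (8 * M))%Z|%N, (a %/ (8 * M))%Z.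
rewrite gez0_abs ?modz_ge0 ?gt_eqF ?mulr_gt0 //.
by rewrite addrC mulrC -divz_eq.
Qed.

Lemma X_add a b : X (a + b) = (X a * X b)%g.
Proof.
have [n [q ->]] := X_repr a; have [p [r ->]] := X_repr b.
have -> : Posz n + 8 * M * q + (Posz p + 8 * M * r) =
  Posz (n + p) + 8 * M * (q + r) by rewrite PoszD; ring.
by rewrite !X_period !X_nat expgD.
Qed.

Lemma X_inj a b : X a = X b -> (8 * M %| a - b)%Z.
Proof.
have [n [q ->]] := X_repr a; have [p [r ->]] := X_repr b.
rewrite !X_period !X_nat => /eqP; rewrite eq_expg_mod_order ox => np.
have : (8 * M %| Posz n - Posz p)%Z by rewrite -eqz_mod_dvd /M -PoszM !modz_nat.
case/dvdzP=> t tE; apply/dvdzP; exists (t + q - r).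
by rewrite -(subrK (Posz p) (Posz n)) tE; ring.
Qed.

Lemma X_y a : (X a * y = y * X ((4 * M - 1) * a))%g.
Proof.
have [n [q ->]] := X_repr a.
have -> : (4 * M - 1) * (Posz n + 8 * M * q) =
   Posz ((4 * 2 ^ j - 1) * n) + 8 * M * ((4 * M - 1) * q).
  rewrite PoszM -subzn; last by rewrite muln_gt0 expn_gt0.
  by rewrite PoszM -/M; ring.
rewrite !X_period !X_nat expgM conjgC conjXg; congr (_ * _ ^+ _)%g.
have yV : (y^-1 = y)%g by apply: (mulgI y); rewrite mulgV.
by rewrite conjgE yV mulgA yx -mulgA (_ : y * y = 1)%g // mulg1.
Qed.

Lemma mulXY a b : (X a * (y * X b) = y * X ((4 * M - 1) * a + b))%g.
Proof. by rewrite mulgA X_y X_add mulgA. Qed.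

Lemma mulYX a b : (y * X a * X b = y * X (a + b))%g.
Proof. by rewrite X_add mulgA. Qed.

Lemma mulYY a b : (y * X a * (y * X b) = X ((4 * M - 1) * a + b))%g.
Proof. by rewrite -mulgA mulXY mulgA (_ : y * y = 1)%g // mul1g. Qed.

Lemma YX_neq a b : X a <> (y * X b)%g.
Proof.
move=> E; case/negP: yNx; rewrite -[y](mulgK (X b)) -E groupM ?groupV //; exact: mem_cycle.
Qed.

Lemma X_in a : X a \in G.
Proof. by rewrite -defG; apply/(subsetP (mulG_subl _ _))/mem_cycle. Qed.

Lemma y_in : y \in G.
Proof. by rewrite -defG; apply/(subsetP (mulG_subr _ _))/cycle_id. Qed.

Lemma YX_in a : (y * X a)%g \in G.
Proof. by rewrite groupM ?y_in ?X_in. Qed.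

Variant semidihedral_spec (g : gT) : Prop :=
  | SpecX a of g = X a
  | SpecYX a of g = (y * X a)%g.

Lemma inGP g : g \in G -> semidihedral_spec g.
Proof.
rewrite -defG => /mulsgP[_ _ /cycleP[a ->] /cycleP[b ->] ->].
rewrite -X_nat -(odd_double_half b) expgD -mul2n expgM y2 expg1n mulg1.
case: (odd b); last by rewrite expg0 mulg1; apply: SpecX.
by rewrite expg1 X_y; apply: SpecYX.
Qed.

(** * Avoidable sets as separating colourings *)

(** [P] and [Q] record membership in the first block on <x> and on its other coset; the product
    formulas give the clauses of [separatesX] and [separatesY]. *)
Lemma avoidable_separates U : avoidable G U ->
  exists P Q, [/\ periodic M P, periodic M Q,
    forall s, X s \in U -> separatesX M P Q s &
    forall t, (y * X t)%g \in U -> separatesY M P Q t].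
Proof.
case/andP=> _ /existsP[A /existsP[B /and3P[_ AB /forallP colAB]]].
have col u v := forallP (colAB u) v.
have GAB : G = A :|: B :> {set gT}.
  by rewrite -(cover_partition AB) /cover bigcup_setU !big_set1.
have sep u v : u \in G -> v \in G -> u != v -> (u * v)%g \in U ->
    (u \in A) != (v \in A).
  move=> Gu Gv uv Uuv; apply/negP => /eqP uvA; have /implyP uvU := col u v.
  have /negP[] // : (u * v)%g \notin U; apply: uvU; rewrite uv uvA.
  by move: Gu Gv; rewrite GAB !inE uvA; case: (v \in A) => //= -> ->.
have Xneq a b : ~~ (8 * M %| a - b)%Z -> X a != X b.
  by apply: contra => /eqP/X_inj.
exists (fun a => X a \in A), (fun a => (y * X a)%g \in A); split.
- by move=> a q; rewrite X_period.
- by move=> a q; rewrite X_period.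
- move=> s Us; split=> a b q ab nd; apply: sep; rewrite ?X_in ?YX_in ?Xneq //.
  + by rewrite -X_add ab X_period.
  + by rewrite (inj_eq (mulgI y)) Xneq.
  + by rewrite mulYY ab X_period.
- have XY a b : X a != (y * X b)%g by apply/eqP/YX_neq.
  move=> t Ut; split=> a b q ab; last first.
    by apply: sep; rewrite ?X_in ?YX_in // mulXY ab X_period.
  rewrite eq_sym; apply: sep; rewrite ?X_in ?YX_in 1?eq_sym //.
  by rewrite mulYX addrC ab X_period.
Qed.

(** The blocks are the set coloured [true] and its complement in G. The condition on [P 0] ensures
    that both colours occur, so that neither block is empty. *)
Lemma separates_avoidable (U : {set gT}) P Q a :
    U \subset G -> periodic M P -> periodic M Q -> (P 0 != P a) || (P 0 != Q a) ->
    (forall s, X s \in U -> separatesX M P Q s) ->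
    (forall t, (y * X t)%g \in U -> separatesY M P Q t) ->
  avoidable G U.
Proof.
move=> UG perP perQ P0 sepX sepY; rewrite /avoidable UG /=.
pose A := [set X i%:Z | i : 'I_(8 * 2 ^ j) & P i%:Z]
  :|: [set (y * X i%:Z)%g | i : 'I_(8 * 2 ^ j) & Q i%:Z].
have residue z : exists2 i : 'I_(8 * 2 ^ j), X z = X i%:Z &
    forall f, periodic M f -> f z = f i%:Z.
  have M0 : 0 < 8 * M by rewrite mulr_gt0 // M_gt0.
  have zM : (`|(z %% (8 * M))%Z| < 8 * 2 ^ j)%N.
    by rewrite -ltz_nat gez0_abs ?modz_ge0 ?gt_eqF // ltz_pmod.
  have per f : periodic M f -> f z = f `|(z %% (8 * M))%Z|%N.
    move=> perf; rewrite gez0_abs ?modz_ge0 ?gt_eqF //.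
    by rewrite -[RHS](perf _ (z %/ (8 * M))%Z) [8 * M * _]mulrC addrC -divz_eq.
  exists (Ordinal zM) => //=; rewrite X_nat //.
have perE f u v : periodic M f -> (8 * M %| u - v)%Z -> f u = f v.
  move=> perf /dvdzP[q uv]; rewrite -(perf v q); congr f.
  by rewrite -[LHS](subrK v) uv; ring.
have XA z : (X z \in A) = P z.
  apply/setUP/idP => [[]/imsetP[i]|Pz].
  - by rewrite inE => Pi /X_inj /(perE P _ _ perP) ->.
  - by move=> _ /YX_neq.
  left; have [i zi /(_ P perP) Pi] := residue z.
  by apply/imsetP; exists i; rewrite // inE -Pi.
have YA z : ((y * X z)%g \in A) = Q z.
  apply/setUP/idP => [[]/imsetP[i]|Qz].
  - by move=> _ /esym/YX_neq.
  - by rewrite inE => Qi /mulgI/X_inj /(perE Q _ _ perQ) ->.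
  right; have [i zi /(_ Q perQ) Qi] := residue z.
  by apply/imsetP; exists i; rewrite ?zi // inE -Qi.
have AG : A \subset G.
  by apply/subsetP=> g /setUP[]/imsetP[i _ ->]; rewrite ?X_in ?YX_in.
have [g [h [gG hG gA hA]]] : exists g h, [/\ g \in G, h \in G, g \in A & h \notin A].
  have [z zG zA] : exists2 z, z \in G & (X 0 \in A) != (z \in A).
    case/orP: P0 => P0; [exists (X a) | exists (y * X a)%g];
    by rewrite ?X_in ?YX_in ?XA ?YA.
  move: zA; case X0: (X 0 \in A); case zA: (z \in A) => // _.
    by exists (X 0), z; rewrite zG X_in X0 zA.
  by exists z, (X 0); rewrite zG X_in X0 zA.
have sep u v : u \in G -> v \in G -> u != v -> (u * v)%g \in U ->
    (u \in A) != (v \in A).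
  move=> /inGP[] b -> /inGP[] c ->; rewrite ?XA ?YA.
  - rewrite -X_add => bc /sepX[H _]; apply: (H _ _ 0); first by rewrite mulr0 addr0.
    by apply: contra bc => /dvdzP[q E]; rewrite -(subrK c b) E addrC [q * _]mulrC X_period.
  - by rewrite mulXY => _ /sepY[_ H]; apply: (H _ _ 0); rewrite mulr0 addr0.
  - rewrite mulYX => _ /sepY[H _]; rewrite eq_sym.
    by apply: (H _ _ 0); rewrite mulr0 addr0 addrC.
  rewrite mulYY => bc /sepX[_ H]; apply: (H _ _ 0); first by rewrite mulr0 addr0.
  by apply: contra bc => /dvdzP[q E]; rewrite -(subrK c b) E addrC [q * _]mulrC X_period.
apply/existsP; exists A; apply/existsP; exists (G :\: A); apply/and3P; split.
- by apply/eqP=> /setP/(_ h); rewrite in_setD hG (negPf hA).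
- apply/and3P; split.
  + rewrite /cover bigcup_setU !big_set1 eqEsubset subUset AG subsetDl /=.
    by apply/subsetP=> k kG; rewrite !inE kG andbT orbN.
  + apply/trivIsetP=> B C; rewrite !inE => /orP[]/eqP-> /orP[]/eqP->; rewrite ?eqxx // => _.
      by rewrite -setI_eq0 setIDA setIC setDIl setDv setI0.
    by rewrite -setI_eq0 setIDAC setDIl setDv setI0.
  + rewrite !inE negb_or; apply/andP; split.
      by apply: contraTneq gA => <-; rewrite inE.
    by apply/eqP=> /setP/(_ h); rewrite in_setD in_set0 hA hG.
- apply/forallP=> u; apply/forallP=> v; apply/implyP=> /andP[uv uvA].
  have [uG vG] : u \in G /\ v \in G.
    case/orP: uvA => /andP[]; last by rewrite !in_setD => /andP[_ ->] /andP[_ ->].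
    by move=> /(subsetP AG) -> /(subsetP AG) ->.
  apply/negP=> /(sep u v uG vG uv); move: uvA.
  by rewrite !in_setD uG vG; case: (u \in A) (v \in A) => [] [].
Qed.

(** * Powers of 2 and congruent exponents *)

Lemma pow2_inv_odd (w : int) : exists u q : int, (2 * w + 1) * u = 1 + 8 * M * q.
Proof.
have cop : coprimez (2 * w + 1) (8 * M).
  have -> : 8 * M = 2 ^+ (j + 3) by rewrite /M -[Posz _]natz natrX exprD mulrC.
  (* Bezout relation between 2w + 1 and 2. *)
  rewrite coprimezXr //; apply/coprimezP; exists (1, - w) => /=; lia.
have [[u q] /= uE] := coprimezP _ _ cop; exists u, (- q).
by apply: (addIr (q * (8 * M))); rewrite mulrC uE; ring.
Qed.

Lemma pow2_decomposition (z : int) : z != 0 ->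
  exists w, z = (2 ^ logn 2 `|z|)%N%:Z * (2 * w + 1).
Proof.
move=> z0; have [|n cn nE] := @pfactor_coprime 2 `|z| isT; first by rewrite absz_gt0.
have [w zw] : exists w, z = (2 ^ logn 2 `|z|)%N%:Z * w.
  have /dvdzP[w zw] : ((2 ^ logn 2 `|z|)%N%:Z %| z)%Z by exact: pfactor_dvdnn.
  by exists w; rewrite mulrC.
rewrite coprime2n in cn.
have nw : n = `|w|%N.
  apply/eqP; rewrite -(@eqn_pmul2r (2 ^ logn 2 `|z|)) ?expn_gt0 // -nE mulnC.
  by rewrite {1}zw abszM absz_nat.
exists (w %/ 2)%Z; rewrite [LHS]zw; congr (_ * _).
by move: cn; rewrite nw; lia.
Qed.

Lemma X_congr a b : (8 * M %| a - b)%Z -> X a = X b.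
Proof.
case/dvdzP=> q ab; rewrite -(subrK b a) ab addrC [q * _]mulrC; exact: X_period.
Qed.

Lemma separatesX_congr P Q s t :
  separatesX M P Q s -> (8 * M %| t - s)%Z -> separatesX M P Q t.
Proof.
move=> [sP sQ] /dvdzP[z zE]; split=> a b q ab; [apply: (sP _ _ (z + q))|apply: (sQ _ _ (z + q))];
by rewrite ab -(subrK s t) zE; ring.
Qed.

(** * Avoidable sets containing an even power of x *)

Lemma avoidable_even U s : avoidable G U -> X (2 * s) \in U ->
  forall g, g \in U -> exists t, g = X (2 * t).
Proof.
move=> avU Us g Ug.
have [P [Q [perP perQ sX sY]]] := avoidable_separates U avU.
have Gg : g \in G by case/andP: avU => /subsetP/(_ g Ug).
case: (inGP g Gg) => a gE; rewrite gE in Ug *.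
  have [t [tE|tE]] : exists t, a = 2 * t \/ a = 2 * t + 1 by exists (a %/ 2)%Z; lia.
    by exists t; rewrite tE.
  rewrite tE in Ug.
  by case: (separates_even_odd M M_gt0 pow2_inv_odd P Q perQ s t (sX _ Us) (sX _ Ug)).
by case: (separates_even_Y M M_gt0 P Q perP s a (sX _ Us) (sY _ Ug)).
Qed.

Lemma avoidable_three U r s t : avoidable G U ->
    X (2 * r) \in U -> X (2 * s) \in U -> X (2 * t) \in U ->
  [|| X (2 * r) == X (2 * s), X (2 * r) == X (2 * t) | X (2 * s) == X (2 * t)].
Proof.
move=> avU Ur Us Ut.
have [P [Q [perP perQ sX sY]]] := avoidable_separates U avU.
apply: contraT; rewrite !negb_or => /and3P[rs rt st].
by case: (separates_three M P Q r s t _ _ _ (sX _ Ur) (sX _ Us) (sX _ Ut));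
   [move: rs | move: rt | move: st]; apply: contra => /X_congr ->.
Qed.

(** An avoidable set containing the pair consists of even powers, of which it has at most two. *)
Lemma pair_saturated s t :
    X (2 * s) != X (2 * t) -> avoidable G [set X (2 * s); X (2 * t)] ->
  saturated G [set X (2 * s); X (2 * t)].
Proof.
move=> st av; apply/maxsetP; split=> // V avV sub; apply/eqP; rewrite eqEsubset sub andbT.
have Vs : X (2 * s) \in V by apply: (subsetP sub); rewrite !inE eqxx.
have Vt : X (2 * t) \in V by apply: (subsetP sub); rewrite !inE eqxx orbT.
apply/subsetP=> g Vg; have [r gE] := avoidable_even V s avV Vs g Vg.
rewrite gE in Vg *; have := avoidable_three V s t r avV Vs Vt Vg.
by rewrite (negPf st) !inE ![_ == X (2 * r)]eq_sym.
Qed.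

Lemma pair_saturated_nat p q : ~~ odd p -> ~~ odd q -> (x ^+ p != x ^+ q)%g ->
  avoidable G [set (x ^+ p)%g; (x ^+ q)%g] -> saturated G [set (x ^+ p)%g; (x ^+ q)%g].
Proof.
have XE i : ~~ odd i -> (x ^+ i)%g = X (2 * i./2%:Z).
  by move=> ie; rewrite -PoszM X_nat mul2n even_halfK.
by move=> /XE -> /XE ->; apply: pair_saturated.
Qed.

Lemma avoidable_unit_half : avoidable G [set 1%g; (x ^+ (4 * 2 ^ j))%g].
Proof.
have [P [Q [perP perQ s0 s4]]] := separates_unit_half M M_gt0 pow2_inv_odd.
have X1 : 1%g = X 0 by rewrite (X_nat 0) expg0.
have X4 : (x ^+ (4 * 2 ^ j))%g = X (4 * M) by rewrite -X_nat.
rewrite X1 X4; apply: (separates_avoidable _ P Q (4 * M)) => //.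
- by rewrite subUset !sub1set !X_in.
- apply/orP; left; apply: (s4.1 _ _ 0); first by ring.
  by have := ndvd_half M M_gt0 0; rewrite add0r.
- by move=> s; rewrite !inE => /orP[] /eqP/X_inj; apply: separatesX_congr.
- by move=> t; rewrite !inE => /orP[] /eqP/esym/YX_neq.
Qed.

(** Here p and q are odd multiples of 2D with D dividing M, and q - p is an odd multiple of 2F =
    2^k. As x^p and x^q differ, k is at most j + 2, so 2F divides 4M. *)
Lemma avoidable_pair p q : ~~ odd p -> ~~ (4 * 2 ^ j %| p)%N ->
    logn 2 p = logn 2 q -> (x ^+ p != x ^+ q)%g ->
  avoidable G [set (x ^+ p)%g; (x ^+ q)%g].
Proof.
move=> p_even p4 pq xpq.
have X4 : (4 * 2 ^ j)%N = (2 ^ j.+2)%N by rewrite !expnS mulnA.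
have p0 : Posz p != 0 by apply: contraNneq p4 => -[->]; rewrite dvdn0.
have [s pE] := pow2_decomposition p p0; rewrite absz_nat in pE.
have v0 : (0 < logn 2 p)%N.
  by rewrite logn_gt0 mem_primes /= dvdn2 p_even andbT lt0n; case: (p) p0.
have vj : (logn 2 p <= j.+1)%N.
  by rewrite leqNgt; apply: contra p4; rewrite X4 -pfactor_dvdn ?lt0n //; case: (p) p0.
have q0 : Posz q != 0.
  by apply: contraTneq v0 => -[q0]; rewrite pq q0 logn0.
have [t qE] := pow2_decomposition q q0; rewrite absz_nat -pq in qE.
set v := logn 2 p in pE qE v0 vj.
have vE : (2 ^ v)%N%:Z = 2 * (2 ^ v.-1)%N%:Z by rewrite -PoszM -expnS prednK.
rewrite vE in pE qE; set D := Posz (2 ^ v.-1) in pE qE.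
have ME : M = D * (2 ^ (j - v.-1))%N by rewrite -PoszM -expnD subnKC //; lia.
have D0 : 0 < D by rewrite ltz_nat expn_gt0.
have npq : ~~ (8 * M %| Posz q - Posz p)%Z.
  by apply: contra xpq => /X_congr; rewrite !X_nat => ->.
have z0 : Posz q - Posz p != 0 by apply: contraNneq npq => ->; rewrite dvdz0.
have [w] := pow2_decomposition _ z0; set k := logn 2 _ => zE.
have k0 : (0 < k)%N.
  rewrite logn_gt0 mem_primes /= absz_gt0 z0 /=.
  have : (2 %| Posz q - Posz p)%Z by apply/dvdzP; exists (2 * D * (t - s)); rewrite qE pE; ring.
  by [].
have kj : (k <= j.+2)%N.
  rewrite leqNgt; apply: contra npq => kj.
  have -> : 8 * M = (2 ^ j.+3)%N by rewrite -PoszM !expnS !mulnA.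
  by rewrite zE dvdz_mulr // dvdzE dvdn_exp2l.
have kE : (2 ^ k)%N%:Z = 2 * (2 ^ k.-1)%N%:Z by rewrite -PoszM -expnS prednK.
have F0 : 0 < (2 ^ k.-1)%N%:Z by rewrite ltz_nat expn_gt0.
have FE : 4 * M = 2 * (2 ^ k.-1)%N%:Z * (2 ^ (j.+2 - k))%N%:Z.
  by rewrite -kE -!PoszM -expnD subnKC // !expnS mulnA.
have stE : 2 * D * (2 * t + 1) - 2 * D * (2 * s + 1) = 2 * (2 ^ k.-1)%N%:Z * (2 * w + 1).
  by rewrite -pE -qE -kE.
have [P [Q [perP perQ]]] :=
  separates_same_valuation M M_gt0 pow2_inv_odd D _ s t _ _ w D0 ME F0 FE stE.
rewrite -pE -qE -!X_nat => sp sq.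
apply: (separates_avoidable _ P Q p) => //.
- by rewrite subUset !sub1set !X_in.
(* Both colours occur since 0 and p are mirror images for x^p and differ modulo 8M. *)
- apply/orP; left; apply: (sp.1 _ _ 0); first by ring.
  rewrite dvdz_subC subr0; apply: contra p4.
  have -> : 8 * M = (8 * 2 ^ j)%N by [].
  by apply: dvdn_trans; rewrite dvdn_mul.
- by move=> r; rewrite !inE => /orP[] /eqP/X_inj; apply: separatesX_congr.
- by move=> r; rewrite !inE => /orP[] /eqP/esym/YX_neq.
Qed.

(** * The unions of two of A, B and C *)

Definition oddz (a : int) := (a %% 2)%Z == 1.

(* The colour is membership in a subgroup of index 2: <x^2, y> if c = false,
   <x^2, y x> if c = true. *)
Lemma separates_parity (c : bool) :
  let P := oddz in let Q a := oddz a (+) c in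
  [/\ periodic M P, periodic M Q, forall s, oddz s -> separatesX M P Q s
    & forall t, oddz t (+) c -> separatesY M P Q t].
Proof.
rewrite /oddz; split.
- by move=> a q; lia.
- by move=> a q; congr (_ (+) _); lia.
- by move=> s so; split=> a b q ab _; case: c; lia.
- by move=> t so; split=> a b q ab; move: so; case: c; lia.
Qed.

(** The colour is membership in <x>, the third subgroup of index 2. *)
Lemma separates_const :
  let P _ := true in let Q _ := false in
  [/\ periodic M P, periodic M Q & forall t, separatesY M P Q t].
Proof. by []. Qed.

Let A := [set (x ^+ (2 * i + 1)%N)%g | i : 'I_(4 * 2 ^ j)].
Let B := [set (y * x ^+ (2 * i)%N)%g | i : 'I_(4 * 2 ^ j)].
Let C := [set (y * x ^+ (2 * i + 1)%N)%g | i : 'I_(4 * 2 ^ j)].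

(** Modulo 8M, the exponents 2b and 2b + 1 depend only on b modulo 4M, which matches the index type
    of the three families. *)
Lemma residue_half b : exists (i : 'I_(4 * 2 ^ j)) q, b = Posz i + 4 * M * q.
Proof.
have M4 : 0 < 4 * M by rewrite mulr_gt0.
have bM : (`|(b %% (4 * M))%Z| < 4 * 2 ^ j)%N.
  by rewrite -ltz_nat gez0_abs ?modz_ge0 ?gt_eqF // ltz_pmod.
exists (Ordinal bM), (b %/ (4 * M))%Z => /=.
by rewrite gez0_abs ?modz_ge0 ?gt_eqF // addrC mulrC -divz_eq.
Qed.

Lemma oddXP g : reflect (exists s, g = X (2 * s + 1)) (g \in A).
Proof.
apply: (iffP imsetP) => [[i _ ->]|[s ->]].
  by exists (Posz i); rewrite -X_nat PoszD PoszM.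
have [i [q ->]] := residue_half s; exists i => //.
rewrite -X_nat PoszD PoszM -[RHS](X_period _ q); congr (X _); ring.
Qed.

Lemma evenYP g : reflect (exists s, g = (y * X (2 * s))%g) (g \in B).
Proof.
apply: (iffP imsetP) => [[i _ ->]|[s ->]].
  by exists (Posz i); rewrite -X_nat PoszM.
have [i [q ->]] := residue_half s; exists i => //.
rewrite -X_nat PoszM -[X (2 * Posz i)](X_period _ q).
congr (_ * X _)%g; ring.
Qed.

Lemma oddYP g : reflect (exists s, g = (y * X (2 * s + 1))%g) (g \in C).
Proof.
apply: (iffP imsetP) => [[i _ ->]|[s ->]].
  by exists (Posz i); rewrite -X_nat PoszD PoszM.
have [i [q ->]] := residue_half s; exists i => //.
rewrite -X_nat PoszD PoszM -[X (2 * Posz i + 1)](X_period _ q).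
congr (_ * X _)%g; ring.
Qed.

Lemma mem_families a :
  ((X a \in A) = oddz a) * ((X a \in B) = false) * ((X a \in C) = false) *
  ((y * X a \in A)%g = false) * ((y * X a \in B)%g = ~~ oddz a) *
  ((y * X a \in C)%g = oddz a).
Proof.
have par b : X a = X b -> oddz a = oddz b.
  by move/X_inj/dvdzP => [q ab]; rewrite -(subrK b a) ab /oddz; lia.
have half : a = if oddz a then 2 * (a %/ 2)%Z + 1 else 2 * (a %/ 2)%Z.
  by rewrite /oddz; case: ifP; lia.
have XY b : X a <> (y * X b)%g by apply: YX_neq.
have YX b : (y * X a)%g <> X b by move/esym/YX_neq.
split; [split; [split; [split; [split|]|]|]|].
- apply/oddXP/idP => [[s /par ->]|ao]; first by rewrite /oddz; lia.
  by exists (a %/ 2)%Z; rewrite {1}half ao.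
- by apply/evenYP => -[s /XY].
- by apply/oddYP => -[s /XY].
- by apply/oddXP => -[s /YX].
- apply/evenYP/idP => [[s /mulgI/par ->]|ao]; first by rewrite /oddz; lia.
  by exists (a %/ 2)%Z; rewrite {1}half (negPf ao).
- apply/oddYP/idP => [[s /mulgI/par ->]|ao]; first by rewrite /oddz; lia.
  by exists (a %/ 2)%Z; rewrite {1}half ao.
Qed.

Lemma families_sub : [/\ A \subset G, B \subset G & C \subset G].
Proof.
split; apply/subsetP=> g; [case/oddXP|case/evenYP|case/oddYP] => s ->;
by rewrite ?X_in ?YX_in.
Qed.

Lemma avoidable_AB : avoidable G (A :|: B).
Proof.
have [perP perQ sX sY] := separates_parity true; have [AG BG CG] := families_sub.
apply: (separates_avoidable _ _ _ 1 _ perP perQ) => //.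
- by rewrite subUset AG.
- by move=> s; rewrite inE !mem_families orbF; apply: sX.
- by move=> t; rewrite inE !mem_families /= -addbT; apply: sY.
Qed.

Lemma avoidable_AC : avoidable G (A :|: C).
Proof.
have [perP perQ sX sY] := separates_parity false; have [AG BG CG] := families_sub.
apply: (separates_avoidable _ _ _ 1 _ perP perQ) => //.
- by rewrite subUset AG.
- by move=> s; rewrite inE !mem_families orbF; apply: sX.
- by move=> t; rewrite inE !mem_families /= -[oddz t]addbF; apply: sY.
Qed.

Lemma avoidable_BC : avoidable G (B :|: C).
Proof.
have [perP perQ sY] := separates_const; have [AG BG CG] := families_sub.
apply: (separates_avoidable _ _ _ 0 _ perP perQ) => //.
- by rewrite subUset BG.
- by move=> s; rewrite inE !mem_families.
Qed.

Lemma avoidable_odd_Y U a b c : avoidable G U ->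
    oddz a -> ~~ oddz b -> oddz c ->
  X a \in U -> (y * X b)%g \in U -> (y * X c)%g \in U -> False.
Proof.
move=> avU ao be co Ua Ub Uc.
have [P [Q [perP perQ sX sY]]] := avoidable_separates U avU.
have [t aE] : exists t, a = 2 * t + 1 by exists (a %/ 2)%Z; move: ao; rewrite /oddz; lia.
have [s bE] : exists s, b = 2 * s by exists (b %/ 2)%Z; move: be; rewrite /oddz; lia.
have [d cE] : exists d, c = 2 * d + 1 by exists (c %/ 2)%Z; move: co; rewrite /oddz; lia.
rewrite aE in Ua; rewrite bE in Ub; rewrite cE in Uc.
exact: (separates_odd_Y M M_gt0 pow2_inv_odd P Q perQ t s d (sX _ Ua) (sY _ Ub) (sY _ Uc)).
Qed.

Lemma evenX_notin U g a : avoidable G U -> g \in U ->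
  g \in A :|: B :|: C -> ~~ oddz a -> X a \notin U.
Proof.
move=> avU Ug gABC ae; apply/negP; have -> : a = 2 * (a %/ 2)%Z by move: ae; rewrite /oddz; lia.
move=> /(avoidable_even U _ avU) /(_ g Ug)[t gE].
by move: gABC; rewrite gE !inE !mem_families /oddz; lia.
Qed.

(** In a larger avoidable set, x excludes the even powers, and x together with y excludes every y
    x^a with a odd. *)
Lemma saturated_AB : saturated G (A :|: B).
Proof.
apply/maxsetP; split; first exact: avoidable_AB.
move=> V avV sub; apply/eqP; rewrite eqEsubset sub andbT.
have Vx : X 1 \in V by apply: (subsetP sub); rewrite inE !mem_families.
have Vy : (y * X 0)%g \in V by apply: (subsetP sub); rewrite inE !mem_families.
have VG : V \subset G by case/andP: avV.
apply/subsetP=> g Vg; case: (inGP g (subsetP VG g Vg)) => a gE;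
rewrite gE in Vg *; rewrite inE !mem_families.
  rewrite orbF; apply: contraTT Vg; apply: (evenX_notin _ (X 1)) => //.
  by rewrite !inE !mem_families.
by apply/negP=> ao; apply: (avoidable_odd_Y V 1 0 a).
Qed.

Lemma saturated_AC : saturated G (A :|: C).
Proof.
apply/maxsetP; split; first exact: avoidable_AC.
move=> V avV sub; apply/eqP; rewrite eqEsubset sub andbT.
have Vx : X 1 \in V by apply: (subsetP sub); rewrite inE !mem_families.
have Vy : (y * X 1)%g \in V by apply: (subsetP sub); rewrite inE !mem_families.
have VG : V \subset G by case/andP: avV.
apply/subsetP=> g Vg; case: (inGP g (subsetP VG g Vg)) => a gE;
rewrite gE in Vg *; rewrite inE !mem_families.
  rewrite orbF; apply: contraTT Vg; apply: (evenX_notin _ (X 1)) => //.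
  by rewrite !inE !mem_families.
by apply: contraT => ae; case: (avoidable_odd_Y V 1 a 1 avV).
Qed.

(** Here y and y x together exclude the odd powers of x, and y alone excludes the even ones. *)
Lemma saturated_BC : saturated G (B :|: C).
Proof.
apply/maxsetP; split; first exact: avoidable_BC.
move=> V avV sub; apply/eqP; rewrite eqEsubset sub andbT.
have Vy0 : (y * X 0)%g \in V by apply: (subsetP sub); rewrite inE !mem_families.
have Vy1 : (y * X 1)%g \in V by apply: (subsetP sub); rewrite inE !mem_families.
have VG : V \subset G by case/andP: avV.
apply/subsetP=> g Vg; case: (inGP g (subsetP VG g Vg)) => a gE;
rewrite gE in Vg *; rewrite inE !mem_families; last by rewrite orNb.
have [ao|ae] := boolP (oddz a); first by case: (avoidable_odd_Y V a 0 1 avV).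
have y0 : (y * X 0)%g \in A :|: B :|: C by rewrite !inE !mem_families.
by case: (negP (evenX_notin V _ a avV Vy0 y0 ae)).
Qed.

(** * Classification of the saturated sets *)

(** Let v be the valuation of p, at most j + 1, and D = 2^(v-1), a divisor of M. If 2^(v+1) divided
    q, then q would be a multiple of 4D, contrary to [separates_valuation]. Exchanging p and q gives
    equal valuations. *)
Lemma avoidable_same_logn U p q : avoidable G U -> ~~ odd p -> ~~ odd q ->
    ~~ (4 * 2 ^ j %| p)%N -> (x ^+ p)%g \in U -> (x ^+ q)%g \in U ->
  (logn 2 q <= logn 2 p)%N && ~~ (4 * 2 ^ j %| q)%N.
Proof.
move=> avU p_even q_even p4 Up Uq.
have [P [Q [perP perQ sX sY]]] := avoidable_separates U avU.
have X4 : (4 * 2 ^ j)%N = (2 ^ j.+2)%N by rewrite !expnS mulnA.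
have p0 : Posz p != 0 by apply: contraNneq p4 => -[->]; rewrite dvdn0.
have [s pE] := pow2_decomposition p p0; rewrite absz_nat in pE.
have v0 : (0 < logn 2 p)%N.
  by rewrite logn_gt0 mem_primes /= dvdn2 p_even andbT lt0n; case: (p) p0.
have vj : (logn 2 p <= j.+1)%N.
  by rewrite leqNgt; apply: contra p4; rewrite X4 -pfactor_dvdn ?lt0n //; case: (p) p0.
have vE : (2 ^ logn 2 p)%N%:Z = 2 * (2 ^ (logn 2 p).-1)%N%:Z by rewrite -PoszM -expnS prednK.
have ME : M = (2 ^ (logn 2 p).-1)%N%:Z * (2 ^ (j - (logn 2 p).-1))%N.
  by rewrite -PoszM -expnD subnKC //; lia.
have : ~~ (2 ^ (logn 2 p).+1 %| q)%N.
  apply/negP=> /dvdnP[t qE].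
  have qE' : Posz q = 4 * (2 ^ (logn 2 p).-1)%N%:Z * t%:Z.
    by rewrite qE PoszM expnS PoszM vE; ring.
  apply: (separates_valuation M M_gt0 pow2_inv_odd P Q perQ _ _ s t ME).
    by rewrite -vE -pE; apply: sX; rewrite X_nat.
  by rewrite -qE'; apply: sX; rewrite X_nat.
move=> vq; apply/andP; split; last first.
  by apply: contra vq; apply: dvdn_trans; rewrite X4 dvdn_exp2l.
rewrite leqNgt; apply: contra vq => vq.
by apply: dvdn_trans (pfactor_dvdnn 2 q); rewrite dvdn_exp2l.
Qed.

Lemma evenX_nat t : exists i : 'I_(4 * 2 ^ j), X (2 * t) = (x ^+ (2 * i))%g.
Proof.
have [i [q ->]] := residue_half t; exists i.
rewrite -X_nat PoszM -[RHS](X_period _ q); congr X; ring.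
Qed.

Lemma unit_half_of_dvd i : (4 * 2 ^ j %| i)%N ->
  (x ^+ i)%g \in [set 1%g; (x ^+ (4 * 2 ^ j))%g].
Proof.
case/dvdnP=> k ->.
have -> : (k * (4 * 2 ^ j) = odd k * (4 * 2 ^ j) + #[x] * k./2)%N.
  by rewrite ox -[in LHS](odd_double_half k) mulnDl -mul2n; congr (_ + _)%N; ring.
rewrite expgD [(x ^+ (#[x] * _))%g]expgM expg_order expg1n mulg1.
by case: (odd k); rewrite ?mul1n ?mul0n !inE eqxx ?orbT.
Qed.

(** A second element of U is an even power of the same valuation, and a third is impossible. If
    there is no second element, maximality is applied to the avoidable pair of x^p and its
    inverse. *)
Lemma saturated_even_pair U p : saturated G U -> ~~ odd p ->
    ~~ (4 * 2 ^ j %| p)%N -> (x ^+ p)%g \in U ->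
  exists q, [/\ ~~ odd q, ~~ (4 * 2 ^ j %| q)%N, (x ^+ p != x ^+ q)%g,
    logn 2 p = logn 2 q & U = [set (x ^+ p)%g; (x ^+ q)%g]].
Proof.
case/maxsetP=> avU maxU p_even p4 Up.
have pX : (x ^+ p)%g = X (2 * p./2%:Z).
  by rewrite -PoszM X_nat mul2n even_halfK.
have [/existsP[g /andP[Ug gp]]|/existsPn Up1] := boolP [exists g, (g \in U) && (g != x ^+ p)%g].
  have Up' := Up; rewrite pX in Up'.
  have [t gE] := avoidable_even U _ avU Up' g Ug.
  have [i gi] := evenX_nat t; rewrite -gE in gi.
  have q_even : ~~ odd (2 * i) by rewrite oddM.
  rewrite gi in Ug gp; rewrite eq_sym in gp.
  have /andP[qp q4] := avoidable_same_logn U p _ avU p_even q_even p4 Up Ug.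
  have /andP[pq _] := avoidable_same_logn U _ p avU q_even p_even q4 Ug Up.
  exists (2 * i)%N; split=> //; first by apply/eqP; rewrite eqn_leq pq.
  apply/eqP; rewrite eqEsubset andbC subUset !sub1set Up Ug /=.
  apply/subsetP=> h Uh; have [s hE] := avoidable_even U _ avU Up' h Uh.
  have := avoidable_three U p./2 t s avU Up'; rewrite -gE -hE -pX gi => /(_ Ug Uh).
  by rewrite (negPf gp) !inE ![_ == h]eq_sym.
(* A natural exponent for the inverse of x^p; the factor [(8 * 2 ^ j).-1] is odd and preserves the
   valuation. *)
pose q := (p * (8 * 2 ^ j).-1)%N.
have N1 : odd (8 * 2 ^ j).-1.
  by rewrite -subn1 oddB ?muln_gt0 ?expn_gt0 // oddM.
have p0 : (0 < p)%N by rewrite lt0n; apply: contraNneq p4 => ->; rewrite dvdn0.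
have q_even : ~~ odd q by rewrite oddM (negPf p_even).
have pq : logn 2 p = logn 2 q.
  by rewrite lognM ?(odd_gt0 N1) // [X in (_ + X)%N]logn_coprime ?addn0 // coprime2n.
have xpq : (x ^+ p != x ^+ q)%g.
  (* If x^p were its own inverse, [8 * 2 ^ j] would divide 2p. *)
  apply: contra p4 => /eqP E.
  have : (x ^+ (p + p) == 1)%g.
    rewrite expgD {2}E -expgD /q -{1}[p]muln1 -mulnDr add1n prednK ?muln_gt0 ?expn_gt0 //.
    by rewrite mulnC -ox expgM expg_order expg1n.
  rewrite -order_dvdn ox addnn -mul2n -[8%N]/(2 * 4)%N -mulnA dvdn_pmul2l //.
have av := avoidable_pair p q p_even p4 pq xpq.
have UE : U = [set (x ^+ p)%g; (x ^+ q)%g].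
  apply: esym; apply: maxU => //; apply/subsetP=> g Ug; have := Up1 g.
  by rewrite Ug /= negbK => /eqP ->; rewrite !inE eqxx.
exists q; split=> //.
have Uq : (x ^+ q)%g \in U by rewrite UE !inE eqxx orbT.
by have /andP[] := avoidable_same_logn U p q avU p_even q_even p4 Up Uq.
Qed.

Lemma saturated_semidihedral U :
  saturated G U <->
    U = [set 1%g; (x ^+ (4 * 2 ^ j))%g]
    \/ (exists p q, [/\ ~~ odd p, ~~ (4 * 2 ^ j %| p)%N && ~~ (4 * 2 ^ j %| q)%N, (x ^+ p != x ^+ q)%g,
          logn 2 p = logn 2 q & U = [set (x ^+ p)%g; (x ^+ q)%g]])
    \/ U = A :|: B
    \/ U = A :|: C
    \/ U = B :|: C.
Proof.
split; last first.
  case=> [->|[[p [q [p_even /andP[p4 _] xpq pq ->]]]|[->|[->|->]]]].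
  - rewrite -(expg0 x); apply: pair_saturated_nat => //; last exact: avoidable_unit_half.
      by rewrite oddM.
    rewrite eq_sym -order_dvdn ox gtnNdvd ?muln_gt0 ?expn_gt0 //.
    by rewrite ltn_mul2r expn_gt0.
  - apply: pair_saturated_nat => //; last exact: avoidable_pair.
    have p0 : (0 < p)%N by rewrite lt0n; apply: contraNneq p4 => ->; rewrite dvdn0.
    have : (0 < logn 2 p)%N by rewrite logn_gt0 mem_primes /= p0 dvdn2.
    by rewrite pq logn_gt0 mem_primes dvdn2 => /and3P[].
  - exact: saturated_AB.
  - exact: saturated_AC.
  - exact: saturated_BC.
move=> satU; have [avU maxU] := maxsetP satU.
have [/existsP[i /and3P[i_even i4 Ui]]|nontriv] :=
    boolP [exists i : 'I_(8 * 2 ^ j), [&& ~~ odd i, ~~ (4 * 2 ^ j %| i)%N & (x ^+ i)%g \in U]].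
  right; left; exists (nat_of_ord i).
  have [q [_ q4 xpq pq UE]] := saturated_even_pair U i satU i_even i4 Ui.
  by exists q; rewrite i4 q4.
have triv t : X (2 * t) \in U -> X (2 * t) \in [set 1%g; (x ^+ (4 * 2 ^ j))%g].
  have [i ->] := evenX_nat t => Ui.
  have iN : (2 * i < 8 * 2 ^ j)%N by rewrite -[8%N]/(2 * 4)%N -mulnA ltn_pmul2l.
  apply: unit_half_of_dvd; apply: contraNT nontriv => i4; apply/existsP.
  by exists (Ordinal iN); rewrite /= oddM i4 Ui.
(* The even powers in U are now among 1 and x^(4M); if there is one, U consists of even powers and
   is contained in that pair. *)
have [/existsP[i /andP[i_even Ui]]|noeven] :=
    boolP [exists i : 'I_(8 * 2 ^ j), ~~ odd i && ((x ^+ i)%g \in U)].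
  left; apply: esym; apply: maxU; first exact: avoidable_unit_half.
  have iX : (x ^+ i)%g = X (2 * i./2%:Z).
    by rewrite -PoszM X_nat mul2n even_halfK.
  rewrite iX in Ui; apply/subsetP=> g Ug.
  by have [t gE] := avoidable_even U _ avU Ui g Ug; rewrite gE in Ug *; apply: triv.
have cover g : g \in U -> g \in A :|: B :|: C.
  have UG : U \subset G by case/andP: avU.
  move=> Ug; case: (inGP g (subsetP UG g Ug)) => a gE;
  rewrite gE in Ug *; rewrite !inE !mem_families; last by rewrite orNb.
  rewrite !orbF; apply: contraNT noeven => ae.
  have aE : a = 2 * (a %/ 2)%Z by move: ae; rewrite /oddz; lia.
  rewrite aE in Ug; have [i iE] := evenX_nat (a %/ 2)%Z.
  have iN : (2 * i < 8 * 2 ^ j)%N by rewrite -[8%N]/(2 * 4)%N -mulnA ltn_pmul2l.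
  by apply/existsP; exists (Ordinal iN); rewrite /= oddM -iE Ug.
right; right.
(* U now lies in A u B u C and misses one of the three; by maximality it is the union of the other
   two. *)
have [/exists_inP[a /oddXP[s ->] Us]|noA] := boolP [exists g in A, g \in U]; last first.
  right; right; apply: esym; apply: maxU; first exact: avoidable_BC.
  apply/subsetP=> g Ug; move: (cover g Ug); rewrite -setUA => /setUP[gA|] //.
  by case/exists_inP: noA; exists g.
have [/exists_inP[b /evenYP[t ->] Ut]|noB] := boolP [exists g in B, g \in U]; last first.
  right; left; apply: esym; apply: maxU; first exact: avoidable_AC.
  apply/subsetP=> g Ug; move: (cover g Ug).
  rewrite (setUC A) -setUA => /setUP[gB|] //.
  by case/exists_inP: noB; exists g.
left; apply: esym; apply: maxU; first exact: avoidable_AB.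
apply/subsetP=> g Ug; move: (cover g Ug); case/setUP => [|/oddYP[r gE]] //.
rewrite gE in Ug.
by case: (avoidable_odd_Y U (2 * s + 1) (2 * t) (2 * r + 1) avU); rewrite // /oddz; lia.
Qed.

End Semidihedral.

Theorem theorem4p8 (gT : finGroupType) (m : nat) (G : {group gT}) (x y : gT)
    (m_gt3 : (3 < m)%N) (SD : semidihedral_presented m G x y) (U : {set gT}) :
  let A := [set x ^+ (2 * i + 1)%N | i : 'I_(2 ^ (m - 2))] in
  let B := [set y * x ^+ (2 * i)%N | i : 'I_(2 ^ (m - 2))] in
  let C := [set y * x ^+ (2 * i + 1)%N | i : 'I_(2 ^ (m - 2))] in
  saturated G U <->
    U = [set 1; x ^+ (2 ^ (m - 2))]
    \/ (exists j s : nat,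
          [/\ [/\ 2 * j != 0 %[mod 2 ^ (m - 1)],
                  2 * j != 2 ^ (m - 2) %[mod 2 ^ (m - 1)],
                  s != 0 %[mod 2 ^ (m - 1)]
                & s != 2 ^ (m - 2) %[mod 2 ^ (m - 1)]],
              2 * j != s %[mod 2 ^ (m - 1)],
              logn 2 (2 * j) = logn 2 s
            & U = [set x ^+ (2 * j)%N; x ^+ s]])
    \/ U = A :|: B
    \/ U = A :|: C
    \/ U = B :|: C.
Proof.
have [ox yNx y2 yx defG] := semidihedral_presented_structure _ _ _ _ _ m_gt3 SD.
have [j mE] : exists j, m = (j + 4)%N by exists (m - 4)%N; lia.
have E2 : (2 ^ (m - 2) = 4 * 2 ^ j)%N by rewrite mE -[4%N]/(2 ^ 2)%N -expnD; congr (2 ^ _)%N; lia.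
have E1 : (2 ^ (m - 1) = 8 * 2 ^ j)%N by rewrite mE -[8%N]/(2 ^ 3)%N -expnD; congr (2 ^ _)%N; lia.
rewrite E2 in yx *; rewrite E1 in ox *.
have N_gt0 : (0 < 4 * 2 ^ j)%N by rewrite muln_gt0 expn_gt0.
(* Since [4 * 2 ^ j] is half the modulus, its multiples have only the residues 0 and [4 * 2 ^ j]. *)
have nontrivial i : ~~ (4 * 2 ^ j %| i)%N =
    (i != 0 %[mod 8 * 2 ^ j]) && (i != 4 * 2 ^ j %[mod 8 * 2 ^ j]).
  rewrite -[8%N]/(2 * 4)%N -mulnA; move: (4 * 2 ^ j)%N N_gt0 => h h0.
  rewrite mod0n (modn_small (m := h)); last by lia.
  rewrite -negb_or; congr (~~ _); apply/idP/orP => [/dvdnP[k ->]|].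
    rewrite -(odd_double_half k) mulnDl -mul2n -mulnA mulnCA.
    rewrite addnC modnMDl.
    case: (odd k); rewrite ?mul1n ?mul0n; last by left; rewrite mod0n.
    by right; rewrite modn_small //; lia.
  rewrite (divn_eq i (2 * h)) modnMDl modn_mod mulnA dvdn_addr; last by rewrite dvdn_mull.
  by case=> /eqP->; rewrite ?dvdn0.
move=> A B C; apply: (iff_trans (saturated_semidihedral _ _ _ _ _ ox yNx y2 yx defG U)).
split=> -[|[|]]; [by left| |by right; right|by left| |by right; right].
  case=> p [q [p_even]]; rewrite !nontrivial eq_expg_mod_order ox.
  move=> /andP[/andP[p0 p4] /andP[q0 q4]] pq vpq UE; right; left; exists p./2, q.
  by rewrite mul2n even_halfK.
case=> i [s [[p0 p4 q0 q4] pq vpq UE]]; right; left; exists (2 * i)%N, s.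
by rewrite oddM !nontrivial p0 p4 q0 q4 eq_expg_mod_order ox.
Qed.
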